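(* Let $n>1$. Amongst the connected Cayley (di)graphs on $\mathbb{Z}^n$ that are not locally finite, some are (D)CI-graphs and some are not. That is, there exists a connected Cayley (di)graph $\mathrm{Cay}(\mathbb{Z}^n;S_1)$ with $S_1$ infinite that is a (D)CI-graph, and there exists a connected Cayley (di)graph $\mathrm{Cay}(\mathbb{Z}^n;S_2)$ with $S_2$ infinite that is not a (D)CI-graph.
   Context: For a group $G$ and a subset $S\subseteq G\setminus\{e\}$, the Cayley digraph $\mathrm{Cay}(G;S)$ has vertex set $G$ and an arc from $g$ to $gs$ for all $g\in G$, $s\in S$; if $S=S^{-1}$ it is regarded as an undirected Cayley graph. It is locally finite if and only if $S$ is finite. The digraph $\mathrm{Cay}(G;S)$ is a DCI-graph if whenever $S'\subseteq G\setminus\{e\}$ and $\mathrm{Cay}(G;S)\cong\mathrm{Cay}(G;S')$ as digraphs, there is a group automorphism $\alpha$ of $G$ with $\alpha(S)=S'$. An undirected Cayley graph (so $S=S^{-1}$) is a CI-graph if the same holds for all $S'=S'^{-1}$. A digraph is called connected if its underlying undirected graph is. The notation ''(D)CI'' means that the statement holds in two versions: for undirected graphs with ''CI'', and for digraphs with ''DCI''. *)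

(* Defs.v *)
From HB Require Import structures.
From mathcomp Require Import all_boot all_order all_algebra.
From mathcomp Require Import boolp classical_sets functions cardinality.
From Stdlib Require Import Relation_Operators.

Set Implicit Arguments.
Unset Strict Implicit.
Unset Printing Implicit Defensive.

Import GRing.Theory.
Local Open Scope classical_set_scope.
Local Open Scope ring_scope.

Section CayleyDigraphs.

(* Groups are abelian and written additively; the identity e is 0. *)
Variable G : zmodType.
Implicit Types (S T : set G) (g h : G).

(* S is contained in G \ {e}. *)
Definition connection_set S : Prop := ~ S 0.

(* S = S^-1. *)
Definition symmetric_set S : Prop := S = [set - s | s in S].

Definition cay_arc S g h : Prop := exists2 s, S s & h = g + s.

(* Any two vertices are joined by a walk that may traverse arcs in either
   direction, i.e. a walk in the underlying undirected graph. *)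
Definition cay_connected S : Prop :=
  forall g h, clos_refl_sym_trans G (cay_arc S) g h.

(* When S and T are symmetric this is isomorphism of undirected graphs. *)
Definition cay_isomorphic S T : Prop :=
  exists2 f : G -> G, bijective f &
    forall g h, cay_arc S g h <-> cay_arc T (f g) (f h).

Definition aut_equivalent S T : Prop :=
  exists2 alpha : {additive G -> G}, bijective alpha & alpha @` S = T.

Definition DCI_graph S : Prop :=
  forall T, connection_set T -> cay_isomorphic S T -> aut_equivalent S T.

(* Intended for symmetric S: T ranges over symmetric sets only. *)
Definition CI_graph S : Prop :=
  forall T, connection_set T -> symmetric_set T ->
    cay_isomorphic S T -> aut_equivalent S T.

End CayleyDigraphs.

(* Main.v *)
Require Import Defs.
From HB Require Import structures.
From mathcomp Require Import all_boot all_order all_algebra.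
From mathcomp Require Import boolp classical_sets functions cardinality.
From mathcomp Require Import zify.
From Stdlib Require Import Relation_Operators.

(** The positive examples are the complete graph: for [S = G \ {0}] the arc
    relation is [g <> h], every bijection transports it to itself, and so any
    isomorphic Cayley digraph has the very same connection set.

    The negative examples are complete multipartite graphs. For a subgroup [H],
    the connection set [G \ H] joins two vertices exactly when they lie in
    different cosets of [H], so its isomorphism type depends only on the index
    and the order of [H]. When both are countably infinite, nothing
    prevents a subgroup with torsion-free quotient from giving the same graph as
    one with torsion in its quotient, whereas a group automorphism matching the
    two connection sets would match the subgroups and identify the quotients. Here [H = {v_1 = 0}], with quotient [Z], is
    compared to [H' = {v_1 = 0, v_0 even}], with quotient [Z * (Z/2)]; the
    bijection [(a, b) |-> (2a + b mod 2, b div 2)] on the coordinates 0 and 1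
    carries the cosets of [H] to those of [H'].

    Both connection sets are symmetric, so each one serves for graphs and for
    digraphs at once. *)

Set Implicit Arguments.
Unset Strict Implicit.
Unset Printing Implicit Defensive.

Import GRing.Theory.
Local Open Scope classical_set_scope.
Local Open Scope ring_scope.

Section CayleyGeneral.
Variable G : zmodType.
Implicit Types (S T : set G) (g h u v : G).

Lemma cay_arcE S g h : cay_arc S g h <-> S (h - g).
Proof.
split=> [[s Ss ->]|Shg]; first by rewrite addrAC subrr add0r.
by exists (h - g) => //; rewrite addrC subrK.
Qed.

Lemma symmetric_setP S : (forall v, S v -> S (- v)) -> symmetric_set S.
Proof.
move=> SN; apply/seteqP; split=> [v Sv|_ [s Ss <-]]; last exact: SN.
by exists (- v); [exact: SN | rewrite opprK].
Qed.

Lemma DCI_graph_CI S : DCI_graph S -> CI_graph S.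
Proof. by move=> dciS T T0 _; exact: dciS. Qed.

(** A single [u] in [S] provides the intermediate vertex [g + u] between any
    two non-adjacent vertices [g] and [h], so the diameter is at most 2. *)
Lemma cay_connected_diam2 S u :
  S u -> (forall v, ~ S v -> S (v - u)) -> cay_connected S.
Proof.
move=> Su S_sub g h; have [Shg|nShg] := pselect (S (h - g)).
  by apply: rst_step; apply/cay_arcE.
apply: (rst_trans _ _ _ (g + u)); apply: rst_step; apply/cay_arcE.
  by rewrite addrAC subrr add0r.
by rewrite opprD addrA; exact: S_sub.
Qed.

Definition nonzero_set : set G := [set v | v <> 0].

Lemma DCI_graph_nonzero : DCI_graph nonzero_set.
Proof.
move=> T T0 [f [f' fK f'K] f_arc].
exists (idfun : {additive G -> G}); first by exists id.
rewrite image_id; apply/seteqP; split=> t; last by move=> Tt t0; rewrite t0 in Tt.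
(* [0 -> t] is an arc of the second graph: pull its ends back, where every two
   distinct vertices are joined. *)
move=> t0; have /f_arc : cay_arc nonzero_set (f' 0) (f' t).
  by apply/cay_arcE => /eqP; rewrite subr_eq0 => /eqP /(can_inj f'K).
by rewrite !f'K => /cay_arcE; rewrite subr0.
Qed.

End CayleyGeneral.

Section IntLattice.
Variables (n : nat) (i0 i1 : 'I_n).
Implicit Types (v w g h : 'rV[int]_n).

(** The complement of the subgroup [v_1 = 0], whose quotient is torsion-free. *)
Definition multipartite_set : set 'rV[int]_n :=
  [set v : 'rV[int]_n | v 0 i1 <> 0].

(** The complement of the subgroup given by [v_1 = 0] and [v_0] even, whose
    quotient has 2-torsion. *)
Definition multipartite_torsion_set : set 'rV[int]_n :=
  [set v : 'rV[int]_n | v 0 i1 <> 0 \/ (v 0%R i0 %% 2)%Z <> 0].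

Lemma multipartite_sub_nonzero : multipartite_set `<=` @nonzero_set _.
Proof. by move=> v v1 v0; apply: v1; rewrite v0 mxE. Qed.

Lemma infinite_multipartite : infinite_set multipartite_set.
Proof.
move=> finS; apply: infinite_nat.
pose f (k : nat) : 'rV[int]_n := const_mx k.+1%:Z.
have -> : [set: nat] = f @^-1` multipartite_set.
  by apply/seteqP; split=> // k _; rewrite /= /multipartite_set /= mxE.
apply: finite_preimage finS => k l _ _ /matrixP/(_ 0 i1).
by rewrite !mxE; lia.
Qed.

Lemma multipartite_symmetric : symmetric_set multipartite_set.
Proof.
apply: symmetric_setP => v; rewrite /multipartite_set /= mxE.
by move: (v 0 i1); lia.
Qed.

Lemma multipartite_torsion_symmetric : symmetric_set multipartite_torsion_set.
Proof.
apply: symmetric_setP => v; rewrite /multipartite_torsion_set /= !mxE.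
by move: (v 0 i0) (v 0 i1); lia.
Qed.

Lemma multipartite_connected : cay_connected multipartite_set.
Proof.
apply: (@cay_connected_diam2 _ _ (const_mx 1)).
  by rewrite /multipartite_set /= mxE.
by move=> v; rewrite /multipartite_set /= !mxE; move: (v 0 i1); lia.
Qed.

Lemma nonzero_connected : cay_connected (@nonzero_set 'rV[int]_n).
Proof.
have nz1 : @nonzero_set 'rV[int]_n (const_mx 1).
  by apply: multipartite_sub_nonzero; rewrite /multipartite_set /= mxE.
apply: (cay_connected_diam2 nz1) => v /contrapT -> /eqP.
by rewrite sub0r oppr_eq0 => /eqP.
Qed.

(** [b |-> (b mod 2, b div 2)] turns a copy of [Z] into [(Z/2) * Z], and
    [(a, r) |-> 2a + r] stores the extra bit in the other coordinate. *)
Definition transfer_bit v : 'rV[int]_n :=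
  \row_j if j == i0 then v 0 i0 * 2 + (v 0%R i1 %% 2)%Z
         else if j == i1 then (v 0%R i1 %/ 2)%Z else v 0 j.

Definition transfer_bit_inv w : 'rV[int]_n :=
  \row_j if j == i0 then (w 0%R i0 %/ 2)%Z
         else if j == i1 then w 0 i1 * 2 + (w 0%R i0 %% 2)%Z else w 0 j.

Hypothesis i10 : i1 != i0.

Lemma transfer_bit_bij : bijective transfer_bit.
Proof.
exists transfer_bit_inv => v; apply/rowP => j;
  rewrite !mxE !eqxx !(negPf i10);
  (have [->|_] := eqVneq j i0; last have [->|_] := eqVneq j i1) => //;
  by move: (v 0 i0) (v 0 i1); lia.
Qed.

Lemma cay_isomorphic_multipartite :
  cay_isomorphic multipartite_set multipartite_torsion_set.
Proof.
exists transfer_bit; first exact: transfer_bit_bij.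
by move=> g h; split=> /cay_arcE Sgh; apply/cay_arcE; move: Sgh;
  rewrite /multipartite_set /multipartite_torsion_set /= !mxE !eqxx (negPf i10);
  move: (g 0 i0) (g 0 i1) (h 0 i0) (h 0 i1); lia.
Qed.

(** If [alpha s = e_0] with [s] outside [H], then [2 s] is still outside [H]
    because [G / H] is torsion-free, although [alpha (2 s) = 2 e_0] is in
    [H']. *)
Lemma not_aut_equivalent_multipartite :
  ~ aut_equivalent multipartite_set multipartite_torsion_set.
Proof.
move=> [alpha _ alphaS]; pose e0 : 'rV[int]_n := delta_mx 0 i0.
have : multipartite_torsion_set e0.
  by right; rewrite /e0 mxE !eqxx.
rewrite -alphaS => -[s Ss alpha_s].
have : multipartite_torsion_set (alpha (s + s)).
  rewrite -alphaS; exists (s + s) => //.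
  by move: Ss; rewrite /multipartite_set /= mxE; move: (s 0 i1); lia.
rewrite raddfD alpha_s /e0 /multipartite_torsion_set /= !mxE !eqxx (negPf i10).
by case.
Qed.

Lemma not_CI_graph_multipartite : ~ CI_graph multipartite_set.
Proof.
move=> ciS; apply: not_aut_equivalent_multipartite; apply: ciS.
- by rewrite /connection_set /multipartite_torsion_set /= !mxE => -[].
- exact: multipartite_torsion_symmetric.
- exact: cay_isomorphic_multipartite.
Qed.

End IntLattice.

Theorem corollary4p1 (n : nat) (hn : (1 < n)%N) :
  ((exists S1 : set 'rV[int]_n,
      [/\ connection_set S1, symmetric_set S1, cay_connected S1,
          infinite_set S1 & CI_graph S1]) /\
   (exists S2 : set 'rV[int]_n,
      [/\ connection_set S2, symmetric_set S2, cay_connected S2,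
          infinite_set S2 & ~ CI_graph S2])) /\
  ((exists S1 : set 'rV[int]_n,
      [/\ connection_set S1, cay_connected S1,
          infinite_set S1 & DCI_graph S1]) /\
   (exists S2 : set 'rV[int]_n,
      [/\ connection_set S2, cay_connected S2,
          infinite_set S2 & ~ DCI_graph S2])).
Proof.
pose i0 : 'I_n := Ordinal (ltnW hn); pose i1 : 'I_n := Ordinal hn.
have i10 : i1 != i0 by [].
pose K := @nonzero_set 'rV[int]_n; pose M := @multipartite_set n i1.
have K0 : connection_set K by exact.
have symK : symmetric_set K.
  by apply: symmetric_setP => v v0 /eqP; rewrite oppr_eq0 => /eqP.
have connK : cay_connected K by exact: (nonzero_connected i1).
have infM : infinite_set M by exact: infinite_multipartite.
have infK : infinite_set K.
  exact: sub_infinite_set (@multipartite_sub_nonzero n i1) infM.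
have M0 : connection_set M by rewrite /connection_set /M /multipartite_set /= mxE.
have connM : cay_connected M by exact: multipartite_connected.
have dciK : DCI_graph K by exact: DCI_graph_nonzero.
have nciM : ~ CI_graph M by exact: not_CI_graph_multipartite i10.
split; split.
- by exists K; split=> //; exact: DCI_graph_CI dciK.
- by exists M; split=> //; exact: multipartite_symmetric.
- by exists K.
- by exists M; split=> // /DCI_graph_CI.
Qed.
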